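(* Let $X,Z$ be metrizable compact spaces, $G$ a finitely generated group, $\psi: G \curvearrowright X$ an action by homeomorphisms, $L+\varphi: G \curvearrowright G+_{\partial_{c}}Z$ a geometric action (with respect to some finite generating set of $G$), $P$ the set of bounded parabolic points of $Z$ (with respect to $\varphi$), and $\pi: X \rightarrow Z$ a continuous surjective equivariant map such that $\#\pi^{-1}(x) = 1$ for all $x \in Z\setminus P$. For $p \in P$ put $W_{p} = X \setminus \pi^{-1}(p)$ and let $\psi_p^1:Stab_\varphi p\curvearrowright W_p$ be the restriction of $\psi$. Then $\pi$ is a blowup map if and only if for every $p \in P$, $X \in EPers(\psi_{p}^{1})$ (with respect to the decomposition $X=W_p\sqcup\pi^{-1}(p)$).
   Context: Groups are discrete. An action of a group $H$ on a locally compact Hausdorff space $V$ is properly discontinuous if for every compact $K\subseteq V$ the set $\{h\in H: hK\cap K\neq\emptyset\}$ is finite, and cocompact if $HK=V$ for some compact $K\subseteq V$. A point $p\in Z$ is bounded parabolic for $\varphi:G\curvearrowright Z$ if $Stab_\varphi p$ acts properly discontinuously and cocompactly on $Z\setminus\{p\}$. A compact Hausdorff space has a unique compatible uniform structure; for an entourage $u$, a subset $A$ is $u$-small if $A\times A\subseteq u$. A continuous surjection $f:X\to Z$ of compact Hausdorff spaces is topologically quasiconvex if for every entourage $u$ of $X$ only finitely many fibers $f^{-1}(z)$ are not $u$-small. $G+_{\partial_c}Z$ denotes a compact space with underlying set $G\sqcup Z$ in which $G$ is discrete and open and $Z$ carries its topology; $L+\varphi$ is the action that is left multiplication on $G$ and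 $\varphi$ on $Z$. Geometric action: let $S$ be a finite generating set of $G$. An action by homeomorphisms of $G$ on a compact metrizable space $G\sqcup Z$ ($G$ discrete and open), restricting to left multiplication on $G$, is geometric with respect to $S$ if for every entourage $u$ there is a finite $K\subseteq G$ such that every geodesic (segment, ray or line, i.e. the set of vertices of such a geodesic in the Cayley graph of $G$ with respect to $S$) not intersecting $K$ is $u$-small. $X\in EPers(\psi^1_p)$ means: for every entourage $u$ of $X$ and every compact $K\subseteq W_p$, the set $\{g\in Stab_\varphi p: \psi(g,K)\text{ is not }u\text{-small}\}$ is finite. (The action of $Stab_\varphi p$ on $W_p$ is properly discontinuous and cocompact.) Blowup map: a continuous surjective equivariant map $\pi:X\to Z$ between compact Hausdorff $G$-spaces, with $\#\pi^{-1}(x)=1$ for every $x\in Z\setminus P$ ($P$ the set of bounded parabolic points of $Z$), such that $\pi$ is topologically quasiconvex and $X\in EPers(\psi_p^1)$ for every $p\in P$. *)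

(* Defs.v *)
From HB Require Import structures.
From mathcomp Require Import all_boot all_order all_algebra.
From mathcomp Require Import all_classical reals topology.

Set Implicit Arguments.
Unset Strict Implicit.
Unset Printing Implicit Defensive.

Import Order.TTheory GRing.Theory Num.Theory.
Local Open Scope classical_set_scope.

Definition generates (G : groupType) (S : set G) : Prop :=
  forall H : set G, H 1%g -> (forall g h, H g -> H h -> H (g * h)%g) ->
    (forall g, H g -> H g^-1%g) -> S `<=` H -> H = [set: G].

Definition finitely_generated (G : groupType) : Prop :=
  exists2 S : set G, finite_set S & generates S.

(* The edges of the Cayley graph join g to g * s for s in S, so that left
   multiplication acts by graph automorphisms. *)
Definition cayley_adj (G : groupType) (S : set G) (g h : G) : Prop :=
  S (g^-1 * h)%g \/ S (h^-1 * g)%g.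

Definition cayley_walk (G : groupType) (S : set G) (n : nat) (g h : G) : Prop :=
  exists w : nat -> G, [/\ w 0%N = g, w n = h &
    forall i, (i < n)%N -> cayley_adj S (w i) (w i.+1)].

(* The graph distance, as a relation: it is also meaningful when S does not
   generate G, in which case points in distinct components have no distance. *)
Definition cayley_dist (G : groupType) (S : set G) (g h : G) (n : nat) : Prop :=
  cayley_walk S n g h /\ forall m, cayley_walk S m g h -> (n <= m)%N.

(* A is the vertex set of a geodesic segment, ray or line: the image of an
   isometric embedding c of [0, n], of [0, +oo[ or of the whole of int. *)
Definition geodesic (G : groupType) (S : set G) (A : set G) : Prop :=
  exists (I : set int) (c : int -> G),
    [/\ [\/ exists n : nat, I = [set i | (0 <= i <= n%:Z)%R],
            I = [set i | (0 <= i)%R] | I = [set: int]],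
        forall i j, I i -> I j -> cayley_dist S (c i) (c j) (absz (i - j)%R) &
        A = c @` I].

(* Each act g is then a homeomorphism, with inverse act g^-1. *)
Definition homeo_action (G : groupType) (T : topologicalType)
    (act : G -> T -> T) : Prop :=
  [/\ forall x, act 1%g x = x,
      forall g h x, act (g * h)%g x = act g (act h x) &
      forall g, continuous (act g)].

Definition stab (G : groupType) (T : Type) (act : G -> T -> T) (p : T) : set G :=
  [set g | act g p = p].

(* In the next two definitions V is a subspace of T that is invariant under
   the subgroup H of G. *)
Definition properly_discontinuous (G : groupType) (T : topologicalType)
    (act : G -> T -> T) (H : set G) (V : set T) : Prop :=
  forall K : set T, compact K -> K `<=` V ->
    finite_set [set h | H h /\ (act h @` K) `&` K !=set0].

Definition cocompact (G : groupType) (T : topologicalType)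
    (act : G -> T -> T) (H : set G) (V : set T) : Prop :=
  exists K : set T, [/\ compact K, K `<=` V & \bigcup_(h in H) (act h @` K) = V].

Definition bounded_parabolic (G : groupType) (Z : topologicalType)
    (phi : G -> Z -> Z) (p : Z) : Prop :=
  properly_discontinuous phi (stab phi p) (~` [set p]) /\
  cocompact phi (stab phi p) (~` [set p]).

Definition small (T : Type) (u : set (T * T)) (A : set T) : Prop :=
  A `*` A `<=` u.

Definition topologically_quasiconvex (X : uniformType) (Z : Type)
    (pi : X -> Z) : Prop :=
  forall u : set (X * X), entourage u ->
    finite_set [set z | ~ small u (pi @^-1` [set z])].

(* EPers for the restriction to W of the action act of the subgroup H. *)
Definition EPers (G : groupType) (X : uniformType) (act : G -> X -> X)
    (H : set G) (W : set X) : Prop :=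
  forall (u : set (X * X)) (K : set X), entourage u -> compact K -> K `<=` W ->
    finite_set [set g | H g /\ ~ small u (act g @` K)].

(* X belongs to EPers(psi^1_p), where W_p is the complement of the fiber. *)
Definition EPers_at (G : groupType) (X : uniformType) (Z : Type)
    (psi : G -> X -> X) (phi : G -> Z -> Z) (pi : X -> Z) (p : Z) : Prop :=
  EPers psi (stab phi p) (~` (pi @^-1` [set p])).

Definition blowup_map (G : groupType) (X Z : uniformType)
    (psi : G -> X -> X) (phi : G -> Z -> Z) (pi : X -> Z) : Prop :=
  [/\ [/\ compact [set: X], hausdorff_space X & homeo_action psi],
      [/\ compact [set: Z], hausdorff_space Z & homeo_action phi],
      [/\ continuous pi, (forall z, exists x, pi x = z) &
          forall g x, pi (psi g x) = phi g (pi x)],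
      forall z, ~ bounded_parabolic phi z -> exists x, pi @^-1` [set z] = [set x] &
      topologically_quasiconvex pi /\
      forall p, bounded_parabolic phi p -> EPers_at psi phi pi p].

(* Y is a compact space with underlying set G + Z, the identification being the
   bijection j, in which G is discrete and open and Z carries its topology. *)
Definition sum_space (G : groupType) (Z Y : topologicalType)
    (j : G + Z -> Y) : Prop :=
  [/\ compact [set: Y], bijective j,
      forall A : set G, open ((j \o inl) @` A) &
      forall U : set Z, open U <->
        exists2 V : set Y, open V & (j \o inr) @^-1` V = U].

Definition left_plus (G : groupType) (Z : Type) (phi : G -> Z -> Z)
    (g : G) (w : G + Z) : G + Z :=
  match w with inl h => inl (g * h)%g | inr z => inr (phi g z) end.

(* The action act on a space Y = G + Z as in sum_space. *)
Definition geometric (G : groupType) (Z : Type) (Y : uniformType)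
    (S : set G) (j : G + Z -> Y) (act : G -> Y -> Y) : Prop :=
  [/\ homeo_action act,
      forall g h, act g (j (inl h)) = j (inl (g * h)%g) &
      forall u : set (Y * Y), entourage u ->
        exists2 K : set G, finite_set K &
          forall A : set G, geodesic S A -> A `&` K = set0 ->
            small u ((j \o inl) @` A)].

(* Main.v *)
(* Fix an entourage u and let B be the set of points of Z whose fiber is not
   u-small.  Since Z is compact, it suffices that every a in Z has a
   neighborhood meeting B in a finite set.  If the fiber of a is a point, the
   fibers near a lie in a small neighborhood of that point, because pi is a
   closed map.  If a is bounded parabolic, let K be compact with
   Stab(a) K = Z \ {a}.  By EPers only the h in a finite set F of Stab(a) make
   h pi^-1(K) fail to be u-small, and the complement of the compact set F K is
   a neighborhood of a whose points other than a lie in some h K with h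
   outside F, so have u-small fibers. *)
Require Import Defs.
From HB Require Import structures.
From mathcomp Require Import all_boot all_order all_algebra.
From mathcomp Require Import all_classical reals topology.

Set Implicit Arguments.
Unset Strict Implicit.
Unset Printing Implicit Defensive.

Local Open Scope classical_set_scope.

Lemma finite_set_locally (T : topologicalType) (B : set T) :
  compact [set: T] ->
  (forall a : T, exists2 N : set T, nbhs a N & finite_set (B `&` N)) ->
  finite_set B.
Proof.
move=> cT locB; apply: contrapT => infB.
(* A cluster point of this filter has no neighborhood meeting B finitely. *)
pose F := [set A | finite_set (B `\` A)].
have FF : ProperFilter F.
  (* Properness is where [B] being infinite enters: an empty member of [F] would make [B] itself
     finite. *)
  apply: Build_ProperFilter_ex.
    move=> A FA; apply: contrapT => /forallNP A0; apply: infB.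
    by apply: sub_finite_set FA => z Bz; split=> // /A0.
  split.
  - by rewrite /F/= setDT.
  - by move=> A A' FA FA'; rewrite /F/= setDIr finite_setU; split.
  - by move=> A A' AA'; apply: sub_finite_set; exact: setDS.
have [|a [_ clFa]] := cT F FF; first by rewrite /F/= setDT.
have [N Na finBN] := locB a.
have FN : F (~` N) by rewrite /F/= setDE setCK.
by have [z []] := clFa _ _ FN Na.
Qed.

Section fibers.
Variables (X Z : topologicalType) (f : X -> Z).
Hypotheses (cX : compact [set: X]) (hZ : hausdorff_space Z).
Hypothesis cf : continuous f.

Lemma compact_closed_image (C : set X) : closed C -> closed (f @` C).
Proof.
move=> clC; apply: (compact_closed hZ).
apply: continuous_compact; first exact: continuous_subspaceT.
exact: subclosed_compact clC cX (@subsetT _ _).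
Qed.

(** Since [f] is a closed map, the image of the complement of [U°] is closed. It misses [a], and
    over its complement every fiber stays inside [U°]. *)
Lemma nbhs_fiber_subset (a : Z) (U : set X) :
  f @^-1` [set a] `<=` U° -> nbhs a [set z | f @^-1` [set z] `<=` U].
Proof.
move=> aU; apply: (@filterS _ _ _ (~` (f @` (~` U°)))).
  move=> z nz x fxz; apply: interior_subset.
  by apply: contrapT => nUx; apply: nz; exists x.
apply: open_nbhs_nbhs; split.
  by apply/closed_openC/compact_closed_image/open_closedC/open_interior.
by move=> [x nUx fxa]; apply: nUx; exact: aU.
Qed.

(** A closed continuous surjection is a quotient map: a subset of [Z] is the image of its own
    preimage, hence closed once that preimage is. *)
Lemma quotient_continuous (Y : topologicalType) (g : Z -> Y) :
  (forall z, exists x, f x = z) -> continuous (g \o f) -> continuous g.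
Proof.
move=> sf /continuous_closedP cgf; apply/continuous_closedP => A clA.
suff -> : g @^-1` A = f @` ((g \o f) @^-1` A).
  by apply: compact_closed_image; exact: cgf.
apply/seteqP; split => [z Az|_ [x Ax <-]//].
by have [x fxz] := sf z; exists x; rewrite //= fxz.
Qed.

End fibers.

Lemma subset_small (T : Type) (u : set (T * T)) (A B : set T) :
  A `<=` B -> small u B -> small u A.
Proof. by move=> AB uB [x y] [/= /AB Bx /AB By]; apply: uB. Qed.

Lemma small_set1_nbhs (X : uniformType) (u : set (X * X)) (x : X) :
  entourage u -> exists2 U : set X, nbhs x U & small u U.
Proof.
move=> eu; have [v ev vu] := entourage_split_ex eu.
(* As [v] need not be symmetric, both sections are taken, so that any [y], [z] in [U] are linked by
   [(y, x)] and [(x, z)], both in [v]. *)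
exists (xsection v x `&` xsection (v^-1)%relation x).
  by apply: filterI; apply: nbhs_entourage => //; exact: entourage_inv.
move=> [y z] [/= [_ vyx] [vxz _]]; apply: vu; exists x.
  by move: vyx; rewrite /xsection/= inE.
by move: vxz; rewrite /xsection/= inE.
Qed.

Section quasiconvexity.
Variables (G : groupType) (X : uniformType) (Z : topologicalType).
Variables (psi : G -> X -> X) (phi : G -> Z -> Z) (pi : X -> Z).
Hypotheses (cX : compact [set: X]) (cZ : compact [set: Z]).
Hypothesis hZ : hausdorff_space Z.
Hypotheses (psi_action : homeo_action psi) (phi_action : homeo_action phi).
Hypothesis cpi : continuous pi.
Hypothesis pi_equiv : forall g x, pi (psi g x) = phi g (pi x).

Lemma small_fibers_near_set1 (u : set (X * X)) (a : Z) (x : X) :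
  entourage u -> pi @^-1` [set a] = [set x] ->
  nbhs a [set z | small u (pi @^-1` [set z])].
Proof.
move=> eu fibE; have [U Ux uU] := small_set1_nbhs x eu.
have : nbhs a [set z | pi @^-1` [set z] `<=` U].
  by apply: nbhs_fiber_subset => //; rewrite fibE => _ ->.
by apply: filterS => z zU; exact: subset_small zU uU.
Qed.

Lemma small_fibers_near_parabolic (u : set (X * X)) (a : Z) :
  entourage u -> cocompact phi (stab phi a) (~` [set a]) ->
  EPers_at psi phi pi a ->
  nbhs a [set z | z <> a -> small u (pi @^-1` [set z])].
Proof.
move=> eu [K [cK Ka KE]] epers.
have [psi1 psiM _] := psi_action; have [phi1 phiM cphi] := phi_action.
pose L := pi @^-1` K.
have clK : closed K := compact_closed hZ cK.
have cL : compact L.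
  apply: (subclosed_compact _ cX) => //.
  by move/continuous_closedP: cpi; exact.
have La : L `<=` ~` (pi @^-1` [set a]) by move=> x /Ka.
have finF := epers u L eu cL La; set F := [set g | _] in finF.
apply: (@filterS _ _ _ (~` \bigcup_(h in F) (phi h @` K))).
  move=> z zF za; have : (~` [set a]) z by [].
  rewrite -KE => -[h ha [k Kk hkz]].
  (* With [z = phi h k], equivariance makes [psi h^-1] carry the fiber of [z] into that of [k],
     which lies in [L]. *)
  apply: (@subset_small _ _ _ (psi h @` L)).
    move=> x pixz; exists (psi h^-1%g x); last by rewrite -psiM mulgV psi1.
    by rewrite /L/= pi_equiv pixz -hkz -phiM mulVg phi1.
  apply: contrapT => nsmall; apply: zF; exists h => //.
  by exists k.
apply: open_nbhs_nbhs; split.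
  apply/closed_openC/closed_bigcup => // h _; apply: (compact_closed hZ).
  by apply: continuous_compact => //; exact: continuous_subspaceT.
(* The removed closed set misses [a]: since [h] fixes [a], [phi h k = a] would force [k = a], but
   [K] avoids [a]. *)
move=> [h [ha _] [k Kk hka]]; apply: (Ka k Kk) => /=.
by rewrite -[k]phi1 -(mulVg h) phiM hka -[in LHS]ha -phiM mulVg phi1.
Qed.

Lemma EPers_topologically_quasiconvex :
  (forall z, ~ bounded_parabolic phi z ->
     exists x, pi @^-1` [set z] = [set x]) ->
  (forall p, bounded_parabolic phi p -> EPers_at psi phi pi p) ->
  topologically_quasiconvex pi.
Proof.
move=> fib epers u eu; apply: finite_set_locally => // a.
have [pa|/fib[x fibE]] := pselect (bounded_parabolic phi a).
  have [_ coco] := pa.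
  exists [set z | z <> a -> small u (pi @^-1` [set z])].
    exact: small_fibers_near_parabolic (epers a pa).
  apply: (@sub_finite_set _ _ [set a]); last exact: finite_set1.
  by move=> z [/= nz zN]; apply: contrapT => /zN.
exists [set z | small u (pi @^-1` [set z])].
  exact: small_fibers_near_set1 fibE.
by apply: (@sub_finite_set _ _ set0) => // z [].
Qed.

End quasiconvexity.

(** [blowup_map] asks that [phi] be an action by homeomorphisms. This descends from [psi]: the
    action laws lift along the surjection [pi], and [phi g] is continuous because [pi] is a quotient
    map and [phi g \o pi = pi \o psi g]. *)
Lemma homeo_action_quotient (G : groupType) (X Z : topologicalType)
    (psi : G -> X -> X) (phi : G -> Z -> Z) (pi : X -> Z) :
  compact [set: X] -> hausdorff_space Z -> homeo_action psi ->
  continuous pi -> (forall z, exists x, pi x = z) ->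
  (forall g x, pi (psi g x) = phi g (pi x)) -> homeo_action phi.
Proof.
move=> cX hZ [psi1 psiM cpsi] cpi spi pi_equiv; split.
- by move=> z; have [x <-] := spi z; rewrite -pi_equiv psi1.
- by move=> g h z; have [x <-] := spi z; rewrite -!pi_equiv psiM.
- move=> g; apply: (quotient_continuous cX hZ cpi spi).
  have -> : phi g \o pi = pi \o psi g by apply/funext => x /=.
  by move=> x; apply: continuous_comp; [exact: cpsi|exact: cpi].
Qed.

Theorem theorem3p11 (R : realType) (G : groupType) (X Z Y : metricType R)
  (psi : G -> X -> X) (phi : G -> Z -> Z)
  (j : G + Z -> Y) (Lphi : G -> Y -> Y) (pi : X -> Z)
  (X_compact : compact [set: X]) (Z_compact : compact [set: Z])
  (G_fg : finitely_generated G)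
  (psi_action : homeo_action psi)
  (Y_sum : sum_space j)
  (LphiE : forall g w, Lphi g (j w) = j (left_plus phi g w))
  (Lphi_geometric : exists S : set G,
     [/\ finite_set S, generates S & geometric S j Lphi])
  (pi_continuous : continuous pi)
  (pi_surjective : forall z, exists x, pi x = z)
  (pi_equivariant : forall g x, pi (psi g x) = phi g (pi x))
  (pi_fiber : forall z, ~ bounded_parabolic phi z ->
     exists x, pi @^-1` [set z] = [set x]) :
  blowup_map psi phi pi <->
  forall p, bounded_parabolic phi p -> EPers_at psi phi pi p.
Proof.
split=> [[_ _ _ _ []]//|epers].
have hX := @metric_hausdorff _ X; have hZ := @metric_hausdorff _ Z.
have phi_action := homeo_action_quotient X_compact hZ psi_action pi_continuous
  pi_surjective pi_equivariant.
split=> //; split=> //.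
exact: EPers_topologically_quasiconvex phi_action _ _ _ epers.
Qed.
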